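(* Let $\mathcal V$ be a variety of algebras and let $k\ge 3$ be an integer. If $\mathcal V$ satisfies the congruence identity $$\alpha(\beta\circ\gamma\circ\beta)\subseteq\alpha\beta\circ_k\gamma,$$ then $\mathcal V$ satisfies the congruence identity $$\alpha(\beta\circ\gamma\circ\beta)\subseteq\alpha\beta\circ_r\alpha\gamma,$$ where $r=\frac{k^2-4k+9}{2}$ for $k$ odd, and $r=\frac{k^2-3k+4}{2}$ for $k$ even.
   Context: Juxtaposition of binary relations denotes intersection ($\alpha\beta=\alpha\cap\beta$), $\circ$ is relational composition ($a\mathrel{(R\circ S)}b$ iff there is $c$ with $a\mathrel R c\mathrel S b$), and $R\circ_m S$ denotes $R\circ S\circ R\circ S\circ\cdots$ with $m$ alternating factors, starting with $R$ ($m-1$ occurrences of $\circ$). Thus $\alpha\beta\circ_k\gamma$ means $(\alpha\cap\beta)\circ_k\gamma$ and $\alpha\beta\circ_r\alpha\gamma$ means $(\alpha\cap\beta)\circ_r(\alpha\cap\gamma)$. A variety satisfies a congruence identity if the inclusion holds for all algebras $\mathbf A\in\mathcal V$ and all congruences $\alpha,\beta,\gamma$ of $\mathbf A$. *)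

(* Defs.v *)
From Corelib Require Export Relation_Definitions.
From mathcomp Require Export all_boot.

Set Implicit Arguments.
Unset Strict Implicit.
Unset Printing Implicit Defensive.

(* Finitary, single-sorted; constants are operations of arity 0. *)
Record signature := Signature { op : Type; arity : op -> nat }.

(* The carrier may be empty.  An empty algebra satisfies every congruence
   inclusion, so excluding it would not change which inclusions a variety
   satisfies. *)
Record algebra (Sig : signature) := Algebra {
  carrier :> Type;
  interp : forall f : op Sig, ('I_(arity f) -> carrier) -> carrier }.

Inductive term (Sig : signature) : Type :=
| Var of nat
| App (f : op Sig) of ('I_(arity f) -> term Sig).

Fixpoint eval (Sig : signature) (A : algebra Sig) (v : nat -> A)
    (t : term Sig) : A :=
  match t with
  | Var i => v i
  | App f ts => interp (fun i => eval v (ts i))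
  end.

(* A variety is an equational class: the class of all models of some set [E]
   of identities. *)
Definition models (Sig : signature) (E : term Sig -> term Sig -> Prop)
    (A : algebra Sig) : Prop :=
  forall s t, E s t -> forall v : nat -> A, eval v s = eval v t.

Definition variety (Sig : signature) (V : algebra Sig -> Prop) : Prop :=
  exists E : term Sig -> term Sig -> Prop, forall A, V A <-> models E A.

Definition compatible (Sig : signature) (A : algebra Sig) (R : relation A) :=
  forall (f : op Sig) (x y : 'I_(arity f) -> A),
    (forall i, R (x i) (y i)) -> R (interp x) (interp y).

Definition congruence (Sig : signature) (A : algebra Sig) (R : relation A) :=
  equivalence A R /\ compatible R.

Definition relI (X : Type) (R S : relation X) : relation X :=
  fun a b => R a b /\ S a b.

Definition rel_comp (X : Type) (R S : relation X) : relation X :=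
  fun a b => exists c, R a c /\ S c b.

(* [m] alternating factors R, S, R, ... starting with [R].  The case [m = 0]
   is conventional. *)
Fixpoint rel_alt (X : Type) (m : nat) (R S : relation X) : relation X :=
  match m with
  | 0 => @eq X
  | 1 => R
  | (_.+1 as m').+1 => rel_comp R (rel_alt m' S R)
  end.

Declare Scope relation_scope.
Delimit Scope relation_scope with REL.
Notation "R ∩ S" := (relI R S) (at level 40, left associativity)
  : relation_scope.
Notation "R ∘ S" := (rel_comp R S) (at level 50, left associativity)
  : relation_scope.
Notation "R ∘[ m ] S" := (rel_alt m%N R S)
  (at level 50, left associativity, m at level 200) : relation_scope.
Arguments inclusion {A} (R1 R2)%_REL.
Notation "R ⊆ S" := (inclusion R S) (at level 70) : relation_scope.

(* The natural subtractions are written last so that they never truncate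
   for k >= 3, and both divisions by 2 are exact. *)
Definition alt_length (k : nat) : nat :=
  if odd k then (k ^ 2 + 9 - 4 * k) %/ 2 else (k ^ 2 + 4 - 3 * k) %/ 2.

(* Main.v *)
From Stdlib Require Import FunctionalExtensionality ProofIrrelevance.
From mathcomp Require Import zify.
Require Import Defs.

(** Let [a β b γ c β d] and [a α d].  The hypothesis gives a chain
    [a = u_0, u_1, ..., u_k = d] whose steps lie alternately in [α ∩ β] and
    in [γ], but nothing keeps the [γ]-steps inside [α].  The proof produces,
    along with this chain, a companion [v_i] of each [u_i] with [u_i γ v_i]
    and [v_i α a], and routes the [γ]-steps through the companions.

    In the language of Maltsev conditions, the hypothesis amounts to 4-ary
    terms [t_0, ..., t_k] with [u_i = t_i(a,b,c,d)]; the companion is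
    [v_i = t_i(a,b,b,d)].  It is [γ]-related to [u_i] since [b γ c], it is
    [α]-related to [a] since [t_i(x,y,y,x) = x] holds in the variety, and
    [v_i = v_(i+1)] for odd [i].  Terms can be bypassed altogether: the pairs
    [(u_i, v_i)] form a chain in the congruence [γ], seen as a subalgebra of
    [A × A] and hence a member of the variety.  So the hypothesis is applied
    in that algebra, to the elements [(a,a)], [(b,b)], [(c,b)], [(d,d)] and
    to the congruences [α × α], the preimage of [β] under the first
    projection, and the kernel of the second projection.

    For odd [i], the companions satisfy
    [v_i γ u_(i+1) (α ∩ β) u_(i+2) γ v_(i+2)] and [v_i α v_(i+2)].
    The hypothesis in [A], with [γ] and [α ∩ β] in the roles of [β] and [γ],
    links [v_i] to [v_(i+2)] by [k] alternating factors [α ∩ γ] and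
    [α ∩ β]; the first link can start at [u_1] instead of [v_1], as
    [u_1 γ v_1] and [u_1 α v_1].  Two consecutive such links share a factor: when [k] is
    odd each begins and ends with [α ∩ γ], and when [k] is even every other
    link is read backwards.  So each link costs [k - 1] factors, up to one
    extra factor in all.  For [k = 2j+4] the first step [a (α ∩ β) u_1] is
    absorbed by the [j+1] links, giving [(j+1)(k-1)+1] factors; for
    [k = 2j+3] there are [j] links, the first and last [α ∩ β] steps, and the
    extra factor, giving [j(k-1)+3]. *)

Set Implicit Arguments.
Unset Strict Implicit.
Unset Printing Implicit Defensive.

(** * Homomorphisms, subpowers and congruences *)

Definition homomorphism (Sig : signature) (C A : algebra Sig) (h : C -> A) :=
  forall (f : op Sig) (x : 'I_(arity f) -> C),
    h (interp x) = interp (fun i => h (x i)).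

Lemma eval_homomorphism (Sig : signature) (C A : algebra Sig) (h : C -> A)
    (v : nat -> C) (t : term Sig) :
  homomorphism h -> h (eval v t) = eval (fun i => h (v i)) t.
Proof.
move=> hom_h; elim: t => [//|f ts IH] /=; rewrite hom_h; congr interp.
exact/functional_extensionality.
Qed.

(** Identities are inherited by any algebra whose points are separated by
    homomorphisms into a model; two homomorphisms are enough for subalgebras
    of squares. *)
Lemma variety_separated (Sig : signature) (V : algebra Sig -> Prop)
    (C A : algebra Sig) (g h : C -> A) :
  variety V -> V A -> homomorphism g -> homomorphism h ->
  (forall x y, g x = g y -> h x = h y -> x = y) -> V C.
Proof.
move=> [E VE] /VE modA hom_g hom_h gh_inj; apply/VE => s t Est v.
by apply: gh_inj; rewrite !eval_homomorphism //; apply: modA.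
Qed.

Lemma congruence_preimage (Sig : signature) (C A : algebra Sig) (h : C -> A)
    (θ : relation A) :
  homomorphism h -> congruence θ -> congruence (fun x y => θ (h x) (h y)).
Proof.
move=> hom_h [[refl trans sym] comp]; split.
  split=> [x|x y z|x y]; [exact: refl | exact: trans | exact: sym].
by move=> f x y xy; rewrite !hom_h; apply: comp.
Qed.

Lemma equivalence_meet (X : Type) (θ ψ : relation X) :
  equivalence X θ -> equivalence X ψ -> equivalence X (θ ∩ ψ)%REL.
Proof.
move=> [rθ tθ sθ] [rψ tψ sψ].
split=> [x|x y z [xy xy'] [yz yz']|x y [xy xy']]; split.
- exact: rθ.
- exact: rψ.
- exact: tθ yz.
- exact: tψ yz'.
- exact: sθ.
- exact: sψ.
Qed.

Lemma congruence_meet (Sig : signature) (A : algebra Sig) (θ ψ : relation A) :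
  congruence θ -> congruence ψ -> congruence (θ ∩ ψ)%REL.
Proof.
move=> [eθ cθ] [eψ cψ]; split; first exact: equivalence_meet.
by move=> f x y xy; split; [apply: cθ | apply: cψ] => i; case: (xy i).
Qed.

Lemma congruence_eq (Sig : signature) (A : algebra Sig) :
  congruence (@eq A).
Proof.
split; first by split=> [x|x y z -> //|x y ->].
by move=> f x y xy; congr interp; apply/functional_extensionality.
Qed.

Definition congruence_algebra (Sig : signature) (A : algebra Sig)
    (γ : relation A) (γ_comp : compatible γ) : algebra Sig :=
  @Algebra Sig {p : A * A | γ p.1 p.2} (fun f x =>
    exist (fun p => γ p.1 p.2)
      (interp (fun i => (sval (x i)).1), interp (fun i => (sval (x i)).2))
      (γ_comp f _ _ (fun i => svalP (x i)))).

Lemma variety_congruence_algebra (Sig : signature) (V : algebra Sig -> Prop)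
    (A : algebra Sig) (γ : relation A) (γ_comp : compatible γ) :
  variety V -> V A -> V (congruence_algebra γ_comp).
Proof.
move=> varV VA.
apply: (variety_separated (C := congruence_algebra γ_comp)
  (g := fun p => (sval p).1) (h := fun p => (sval p).2) varV VA) => //.
case=> [[x1 x2] x12] [[y1 y2] y12] /= e1 e2.
by subst; congr exist; apply: proof_irrelevance.
Qed.

(** * Alternating compositions *)

(** Where two alternating chains meet, the last factor of the first and the
    first factor of the second are the same transitive relation, so they
    collapse into one; the parity of [m] tells which relation that is. *)
Lemma rel_alt_merge (X : Type) (m n : nat) (R S : relation X) (x y z : X) :
  (forall u v w, R u v -> R v w -> R u w) ->
  (forall u v w, S u v -> S v w -> S u w) ->
  (R ∘[m.+1] S)%REL x y ->
  (if odd m then (S ∘[n.+1] R)%REL else (R ∘[n.+1] S)%REL) y z ->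
  (R ∘[(m + n).+1] S)%REL x z.
Proof.
elim: m R S x => [|m IH] R S x tR tS.
  case: n => [|n]; first exact: tR.
  by move=> xy [w [yw wz]]; exists w; split=> //; apply: (tR) xy yw.
move=> [w [xw wy]] yz; exists w; split=> //.
by apply: IH wy _ => //; move: yz => /=; case: (odd m).
Qed.

Lemma rel_alt_rcons (X : Type) (m : nat) (R S : relation X) (x y z : X) :
  (R ∘[m.+1] S)%REL x y -> (if odd m then R else S) y z ->
  (R ∘[m.+2] S)%REL x z.
Proof.
elim: m R S x => [|m IH] R S x; first by move=> xy yz; exists y.
move=> [w [xw wy]] yz; exists w; split=> //; apply: IH wy _.
by move: yz => /=; case: (odd m).
Qed.

Lemma rel_alt_rev (X : Type) (m : nat) (R S : relation X) (x y : X) :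
  (forall u v, R u v -> R v u) -> (forall u v, S u v -> S v u) ->
  (R ∘[m.+1] S)%REL x y ->
  (if odd m then (S ∘[m.+1] R)%REL else (R ∘[m.+1] S)%REL) y x.
Proof.
move=> symR symS; elim: m R S symR symS x => [|m IH] R S symR symS x.
  exact: symR.
move=> [w [xw wy]]; move: (IH _ _ symS symR _ wy) => /=.
by case: ifP => odd_m yw; apply: rel_alt_rcons yw _; rewrite odd_m; apply: symR.
Qed.

(** * Chains of pairs *)

(** The set underlying [congruence_algebra]: its elements pair a member [u_i]
    of the chain with its companion [v_i]. *)
Definition pair_in (X : Type) (γ : relation X) := {p : X * X | γ p.1 p.2}.

Definition on_fst (X : Type) (γ θ : relation X) : relation (pair_in γ) :=
  fun p q => θ (sval p).1 (sval q).1.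

Definition on_snd (X : Type) (γ θ : relation X) : relation (pair_in γ) :=
  fun p q => θ (sval p).2 (sval q).2.

(** The meet of the congruences that play the roles of [α] and [β] in the
    algebra of pairs; [step_along] is the one in the role of [γ]. *)
Definition step_across (X : Type) (γ α β : relation X) : relation (pair_in γ) :=
  (on_fst α ∩ on_snd α ∩ on_fst β)%REL.

Definition step_along (X : Type) (γ : relation X) : relation (pair_in γ) :=
  on_snd (@eq X).

(** Two steps of the chain of pairs, seen from a point [x] that is
    [γ]-related to the chain and [α]-related to its companion, end in a
    companion that is again [α]-related to [x].  This is where the companions
    recover what the [γ]-steps of the chain lose. *)
Lemma chain_block (X : Type) (α β γ : relation X) (x : X)
    (p q r : pair_in γ) :
  equivalence X α -> equivalence X γ ->
  γ x (sval p).1 -> α x (sval p).2 -> step_along p q -> step_across α β q r ->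
  (α ∩ (γ ∘ (α ∩ β) ∘ γ))%REL x (sval r).2.
Proof.
move=> [_ tα _] [_ tγ sγ] xp1 xp2 pq [[qr1 qr2] qrβ]; split.
  by apply: (tα) xp2 _; rewrite pq.
exists (sval r).1; split; last exact: (svalP r).
exists (sval q).1; split; last by split.
apply: (tγ) xp1 _; apply: (tγ) (svalP p) _; rewrite pq; exact: sγ (svalP q).
Qed.

(** Since [n.+1] is odd, every link begins and ends with [α ∩ γ]: successive
    links merge as they are.  The last two steps of the chain need no link,
    because the penultimate element is [α]-related to the end [e]. *)
Lemma chain_blocks_odd (X : Type) (n j : nat) (α β γ : relation X) (x : X)
    (p e : pair_in γ) :
  equivalence X α -> equivalence X β -> equivalence X γ -> ~~ odd n ->
  (α ∩ (γ ∘ (α ∩ β) ∘ γ) ⊆ (α ∩ γ) ∘[n.+1] (α ∩ β))%REL ->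
  γ x (sval p).1 -> α x (sval p).2 -> (sval e).1 = (sval e).2 ->
  (@step_along X γ ∘[j.*2.+2] step_across α β)%REL p e ->
  ((α ∩ γ) ∘[(j * n).+2] (α ∩ β))%REL x (sval e).2.
Proof.
move=> eα eβ eγ even_n day; have [rα tα sα] := eα; have [_ tγ sγ] := eγ.
have [_ tG _] := equivalence_meet eα eγ.
have [_ tB _] := equivalence_meet eα eβ.
elim: j x p => [|j IH] x p xp1 xp2 ee.
  move=> [q [pq [[qe1 qe2] qeβ]]]; exists (sval q).1; split; last first.
    by rewrite -ee.
  split.
    apply: (tα) xp2 _; rewrite pq; apply: (tα) qe2 _; rewrite -ee; exact: sα.
  apply: (tγ) xp1 _; apply: (tγ) (svalP p) _; rewrite pq; exact: sγ (svalP q).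
rewrite doubleS => -[q [pq [r [qr re]]]].
have xr := day _ _ (chain_block eα eγ xp1 xp2 pq qr).
have re' := IH _ _ (sγ _ _ (svalP r)) (rα _) ee re.
rewrite mulSn -addnS; apply: (rel_alt_merge tG tB xr).
by rewrite (negbTE even_n).
Qed.

(** Since [n.+1] is even, the converse of a link is a link that begins with
    the other relation.  Every link can thus be made to begin with the factor
    that ends the one before it, and the first one can begin with either
    relation; the boolean [s] records the choice. *)
Lemma chain_blocks_even (X : Type) (n j : nat) (α β γ : relation X) (x : X)
    (p e : pair_in γ) (s : bool) :
  equivalence X α -> equivalence X β -> equivalence X γ -> odd n ->
  (α ∩ (γ ∘ (α ∩ β) ∘ γ) ⊆ (α ∩ γ) ∘[n.+1] (α ∩ β))%REL ->
  γ x (sval p).1 -> α x (sval p).2 ->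
  (@step_along X γ ∘[j.*2.+3] step_across α β)%REL p e ->
  ((if s then α ∩ γ else α ∩ β) ∘[(j.+1 * n).+1]
   (if s then α ∩ β else α ∩ γ))%REL x (sval e).2.
Proof.
move=> eα eβ eγ odd_n day; have [rα tα sα] := eα; have [_ tγ sγ] := eγ.
have [_ tG sG] := equivalence_meet eα eγ.
have [_ tB sB] := equivalence_meet eα eβ.
have day_from (t : bool) y z : (α ∩ (γ ∘ (α ∩ β) ∘ γ))%REL y z ->
    ((if t then α ∩ γ else α ∩ β) ∘[n.+1]
     (if t then α ∩ β else α ∩ γ))%REL y z.
  case: t => [|[yz [v [[u [yu uv]] vz]]]]; first exact: day.
  have /(rel_alt_rev sG sB) : ((α ∩ γ) ∘[n.+1] (α ∩ β))%REL z y.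
    apply: day; split; first exact: sα.
    exists u; split; last exact: sγ.
    by exists v; split; [apply: sγ | apply: sB].
  by rewrite odd_n.
elim: j x p s => [|j IH] x p s xp1 xp2.
  move=> [q [pq [r [qr re]]]]; rewrite mul1n -re.
  exact: day_from (chain_block eα eγ xp1 xp2 pq qr).
rewrite doubleS => -[q [pq [r [qr re]]]].
have xr := day_from s _ _ (chain_block eα eγ xp1 xp2 pq qr).
have re' := IH _ _ (~~ s) (sγ _ _ (svalP r)) (rα _) re.
rewrite mulSn; apply: (rel_alt_merge _ _ xr); first by case: (s).
  by case: (s).
by rewrite odd_n; case: (s) re'.
Qed.

Lemma alt_length_odd (j : nat) : alt_length j.*2.+3 = (j * j.*2.+2).+3.
Proof.
rewrite /alt_length /= odd_double /=.
rewrite (_ : _ - _ = (j * j.*2.+2).+3 * 2) ?mulnK //; lia.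
Qed.

Lemma alt_length_even (j : nat) : alt_length j.*2.+4 = (j.+1 * j.*2.+3).+1.
Proof.
rewrite /alt_length /= odd_double /=.
rewrite (_ : _ - _ = (j.+1 * j.*2.+3).+1 * 2) ?mulnK //; lia.
Qed.

Theorem theorem5 (Sig : signature) (V : algebra Sig -> Prop) (k : nat) :
  variety V ->
  3 <= k ->
  (forall (A : algebra Sig) (α β γ : relation A), V A ->
     congruence α -> congruence β -> congruence γ ->
     (α ∩ (β ∘ γ ∘ β) ⊆ (α ∩ β) ∘[k] γ)%REL) ->
  forall (A : algebra Sig) (α β γ : relation A), V A ->
    congruence α -> congruence β -> congruence γ ->
    (α ∩ (β ∘ γ ∘ β) ⊆ (α ∩ β) ∘[alt_length k] (α ∩ γ))%REL.
Proof.
move=> varV k_ge3 hyp A α β γ VA cα cβ cγ a d [ad [c [[b [ab bc]] cd]]].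
(* The inclusion behind Day's characterization of congruence modularity. *)
have day : (α ∩ (γ ∘ (α ∩ β) ∘ γ) ⊆ (α ∩ γ) ∘[k] (α ∩ β))%REL.
  by apply: hyp => //; apply: congruence_meet.
have [eα _] := cα; have [eβ _] := cβ; have [eγ comp_γ] := cγ.
have [rγ _ _] := eγ; have [rα tα sα] := eα.
have [_ _ sγ] := eγ.
have [_ tG _] := equivalence_meet eα eγ.
have [_ tB _] := equivalence_meet eα eβ.
pose C := congruence_algebra comp_γ.
have VC : V C := variety_congruence_algebra comp_γ varV VA.
have fst_hom : @homomorphism Sig C A (fun p => (sval p).1) by [].
have snd_hom : @homomorphism Sig C A (fun p => (sval p).2) by [].
pose diag x : C := exist (fun p => γ p.1 p.2) (x, x) (rγ x).
pose cb : C := exist (fun p => γ p.1 p.2) (c, b) (sγ _ _ bc).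
(* The second coordinates of [(b,b)] and [(c,b)] agree, which puts this pair in
   the kernel of the second projection. *)
have : ((on_fst α ∩ on_snd α ∩ on_fst β) ∘[k] @step_along A γ)%REL
         (diag a) (diag d).
  apply: (hyp C (on_fst α ∩ on_snd α)%REL _ _ VC).
  - apply: congruence_meet; first exact: (congruence_preimage fst_hom cα).
    exact: (congruence_preimage snd_hom cα).
  - exact: (congruence_preimage fst_hom cβ).
  - exact: (congruence_preimage snd_hom (congruence_eq A)).
  split=> //; exists cb; split; last exact: cd.
  by exists (diag b).
case: k k_ge3 {hyp} day => [|[|k]] // k_ge3 day [p [ap pd]].
have [[ap1 ap2] apβ] := ap.
have aBp : (α ∩ β)%REL a (sval p).1 by [].
have pα : α (sval p).1 (sval p).2 by exact: tα (sα _ _ ap1) ap2.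
have [k_odd|k_even] := boolP (odd k).
  have [j Dk] : exists j, k = j.*2.+1 by exists k./2; lia.
  subst k; rewrite alt_length_odd; exists (sval p).1; split=> //.
  by apply: (chain_blocks_odd (n := j.*2.+2) eα eβ eγ _ day (rγ _) pα _ pd);
    rewrite //= odd_double.
have [j Dk] : exists j, k = j.*2.+2 by exists k./2.-1; lia.
subst k; rewrite alt_length_even.
(* The links start with [α ∩ β], to absorb the first step of the chain. *)
apply: (rel_alt_merge (m := 0) tB tG aBp).
apply: (chain_blocks_even false (n := j.*2.+3) eα eβ eγ _ day (rγ _) pα pd).
by rewrite /= odd_double.
Qed.
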